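(* Suppose that there is a sequence $(v_n)_{n\in\mathbb{N}}$ in $(0,1/2)$ such that $nv_n\to\infty$ and $(\log\log(n))^{-1}H_n(v_n)\to\infty$ as $n\to\infty$. Then for every $s\in\mathbb{R}$ $$nS_n(s)-r_n\longrightarrow\infty\quad\text{in } Q_n^n\text{-probability},$$ where $r_n=\log\log(n)+\frac12\log\log\log(n)-\frac12\log(4\pi)$.
   Context: Setting: $P_0$ is a continuous (noise) probability distribution on $\mathbb{R}$ with distribution function $F_0$; $\mu_n$, $n\in\mathbb{N}$, are (signal) probability distributions on $\mathbb{R}$; $\varepsilon_n\in[0,1]$ with $\varepsilon_n\to0$; $Q_n=(1-\varepsilon_n)P_0+\varepsilon_n\mu_n$. For each $n$, $X_{n,1},\ldots,X_{n,n}$ are i.i.d. with distribution $Q_n$; $Q_n^n$ denotes the $n$-fold product measure. Define $H_n:(0,1/2)\to[0,\infty)$ by $$H_n(v)=\frac{\sqrt n\,\varepsilon_n}{\sqrt v}\Bigl(\bigl|\mu_n^{F_0}(0,v]-v\bigr|+\bigl|\mu_n^{F_0}(1-v,1)-v\bigr|\Bigr),$$ where $\mu_n^{F_0}$ is the distribution of $F_0(X)$ when $X\sim\mu_n$. For $s\in\mathbb{R}$ define $\phi_s:[0,\infty)\to\mathbb{R}\cup\{\infty\}$ by $\phi_0(x)=x-\log(x)-1$, $\phi_1(x)=x(\log(x)-1)+1$, and $\phi_s(x)=\dfrac{1-s+sx-x^s}{s(1-s)}$ for $s\neq0,1$. For $u,v\in(0,1)$ put $K_s(u,v)=v\,\phi_s(u/v)+(1-v)\,\phi_s((1-u)/(1-v))$.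 Let $\mathbb{F}_n(x)=n^{-1}\sum_{i=1}^n\mathbf{1}\{X_{n,i}\le x\}$ and let $X_{1:n}\le\ldots\le X_{n:n}$ be the order statistics. The test statistic is $S_n(s)=\sup_{X_{1:n}\le x<X_{n:n}}K_s(\mathbb{F}_n(x),F_0(x))$. ''$Z_n\to\infty$ in $Q_n^n$-probability'' means $Q_n^n(Z_n>K)\to1$ for every $K\in\mathbb{R}$. *)

(* Defs.v *)
From HB Require Import structures.
From mathcomp Require Import all_boot all_order all_algebra.
From mathcomp Require Import all_classical all_reals all_analysis.
Set Implicit Arguments.
Unset Strict Implicit.
Unset Printing Implicit Defensive.
Import Order.TTheory GRing.Theory Num.Theory.
Import numFieldNormedType.Exports.
Local Open Scope classical_set_scope.
Local Open Scope ring_scope.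

(** [prob_power P n] is the n-fold product measure of [P], obtained by iterating
    the binary product; [prob_powerE] is its characteristic product rule. *)
Section product_power.
Context d (T : measurableType d) (R : realType).
Local Open Scope ereal_scope.

Definition cons_tuple n (p : T * n.-tuple T) : n.+1.-tuple T :=
  [tuple of p.1 :: p.2].

Lemma measurable_cons_tuple n : measurable_fun setT (@cons_tuple n).
Proof. exact: measurable_cons. Qed.

HB.instance Definition _ n :=
  isMeasurableFun.Build _ _ _ _ (@cons_tuple n) (@measurable_cons_tuple n).

Fixpoint prob_power (P : probability T R) n : probability (n.-tuple T) R :=
  match n with
  | 0%N => \d_([tuple] : 0.-tuple T)
  | n'.+1 => distribution (P \x prob_power P n') (@cons_tuple n')
  end.

Lemma prob_powerE (P : probability T R) n (A : 'I_n -> set T) :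
  (forall i, measurable (A i)) ->
  prob_power P n [set x | forall i, A i (tnth x i)] = \prod_(i < n) P (A i).
Proof.
elim: n A => [|n IH] A mA.
  by rewrite big_ord0 /= diracE mem_set// => -[].
rewrite big_ord_recl -(IH (fun i => A (lift ord0 i)))//.
rewrite -product_measure1E//; last first.
  rewrite [X in measurable X](_ : _ = \bigcap_(i in [set: 'I_n])
      ((fun x : n.-tuple T => tnth x i) @^-1` A (lift ord0 i))).
    apply: fin_bigcap_measurable; first exact: finite_finset.
    by move=> i _; rewrite -[X in measurable X]setTI; exact: measurable_tnth.
  by apply/seteqP; split => x /= h i; [move=> _; exact: h|exact: h].
rewrite /= /distribution /pushforward; congr (_ _).
apply/seteqP; split => -[a x] /=.
  move=> h; split => [|i]; first exact: (h ord0).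
  by have := h (lift ord0 i); rewrite tnthS.
move=> [h0 h] i; case: (unliftP ord0 i) => [j|] -> //.
by rewrite tnthS; exact: h.
Qed.

End product_power.

Section mixture.
Context d (T : measurableType d) (R : realType).
Variables (e : {i01 R}) (P Q : probability T R).

Definition mixture : set T -> \bar R :=
  measure_add (mscale (1 - e%:num)%:nng P) (mscale e%:num%:nng Q).

HB.instance Definition _ := Measure.on mixture.

Lemma mixtureE A :
  mixture A = ((1 - e%:num)%:E * P A + e%:num%:E * Q A)%E.
Proof. by rewrite /mixture measure_addE. Qed.

Let mixture_setT : mixture setT = 1%E.
Proof. by rewrite mixtureE !probability_setT !mule1 -EFinD subrK. Qed.

HB.instance Definition _ :=
  Measure_isProbability.Build _ _ _ mixture mixture_setT.

End mixture.

Section phi_divergence.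
Variable R : realType.
Implicit Types s x u v t : R.

(** Distribution function of a Borel probability measure on the line. *)
Definition distfun (P : probability (measurableTypeR R) R) t : R :=
  fine (P `]-oo, t]%classic).

(** At [x = 0] the logarithm and the negative powers, which are total functions
    here, are replaced by the limits from the right: the value is infinite for
    [s <= 0].  For [s = 1], [ln 0 = 0] agrees with the convention 0 log 0 = 0.
    Only the values for [0 <= x] are meaningful. *)
Definition phi s x : \bar R :=
  if s == 0 then (if x == 0 then +oo%E else (x - ln x - 1)%:E)
  else if s == 1 then (x * (ln x - 1) + 1)%:E
  else if (s < 0) && (x == 0) then +oo%E
  else ((1 - s + s * x - x `^ s) / (s * (1 - s)))%:E.

(** Meaningful for [u] and [v] in the open unit interval. *)
Definition phi_div s u v : \bar R :=
  (v%:E * phi s (u / v) + (1 - v)%:E * phi s ((1 - u) / (1 - v)))%E.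

Definition edf n (x : n.-tuple R) t : R :=
  n%:R^-1 * \sum_(i < n) (tnth x i <= t)%R%:R.

(** [order_stat x k] is X_{k:n}, for [1 <= k <= n]. *)
Definition order_stat n (x : n.-tuple R) (k : nat) : R :=
  nth 0 (sort <=%R x) k.-1.

(** Supremum in the extended reals. The divergence is defined only when the
    reference value [F0 t] lies in the open unit interval, hence the explicit
    restriction; it excludes points only when [F0] maps some observation to 0
    or 1, an event of probability zero under the noise distribution. *)
Definition phi_stat (F0 : R -> R) s n (x : n.-tuple R) : \bar R :=
  ereal_sup [set phi_div s (edf x t) (F0 t) | t in
    [set t | order_stat x 1 <= t < order_stat x n /\ 0 < F0 t < 1]].

Definition centering (n : nat) : R :=
  ln (ln n%:R) + 2^-1 * ln (ln (ln n%:R)) - 2^-1 * ln (4 * pi).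

Definition signal_strength (F0 : R -> R)
    (mu : probability (measurableTypeR R) R) (e : R) (n : nat) v : R :=
  let muF : set (measurableTypeR R) -> \bar R := pushforward mu F0 in
  Num.sqrt n%:R * e / Num.sqrt v *
    (`|fine (muF `]0, v]%classic) - v| +
     `|fine (muF `](1 - v), 1[%classic) - v|).

End phi_divergence.

Definition cvgy_in_probability (R : realType) (d : nat -> measure_display)
    (T : forall n, measurableType (d n)) (P : forall n, probability (T n) R)
    (Z : forall n, T n -> \bar R) :=
  forall K : R, P n [set x | (K%:E < Z n x)%E] @[n --> \oo] --> 1%E.

(* Main.v *)
From HB Require Import structures.
Require Import Defs.
From mathcomp Require Import all_boot all_order all_algebra.
From mathcomp Require Import all_classical all_reals all_analysis.
From mathcomp Require Import ring lra.
Import Order.TTheory GRing.Theory Num.Theory.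
Import numFieldNormedType.Exports.
Local Open Scope classical_set_scope.
Local Open Scope ring_scope.

(** The statistic is a supremum, so it is enough to exhibit, for each large
    [n], one point [t] at which the divergence between the empirical and the
    noise distribution functions is large with high probability.

    Let [w] and [m] be the masses of the noise and of the signal to the left of
    [t], and let [d = eps * |m - w|] be the distance between [w] and the mean of
    the empirical distribution function at [t].  For every [s] the divergence
    of [u] from [v] is at least a constant times [(u - v)^2 / (v + |u - v|)],
    since [phi s] is quadratic near [1] and grows at least linearly
    ([phi_ge], [phi_div_ge]); by symmetry [v] may be replaced by [1 - v].  By
    Chebyshev's inequality the empirical value is at distance at least [d / 2]
    from [w] outside an event of probability at most [4 / (n B)], where
    [B = d^2 / (min(w, 1 - w) + d)], and then [n] times the statistic is at
    least a constant times [n B] ([phi_stat_gain]).  So everything reduces to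
    finding [t] with [n B] much larger than [ln (ln n)], the order of the
    centering.

    The natural choice is the point where the noise distribution function is
    [v n] or [1 - v n], according to which summand of the signal strength [H]
    dominates.  If [d <= v] then [n B] is at least [n d^2 / (2 v)], hence at
    least of order [H^2]; if [d > v] then [n B] is at least [n d / 2], hence at
    least of order [sqrt (n v) H].  Both are at least of order [H] once [n v >= 1] and
    [H >= 4].  There is one obstruction: [H] ignores the signal mass located
    where the noise distribution function is [0] or [1], whereas this mass
    contributes to [m] and may cancel the difference that [H] measures.  When it
    does, it is itself large, and a point at a small enough level of the noise
    reveals it ([tail_gain_selection]).  In all cases some [t] has
    [n B >= H / 16] ([signal_strength_gain]). *)

(** * Quadratic lower bounds for the divergence *)

Lemma nonneg_derivative_le {R : realType} (h d : R -> R) (z : R) :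
  (forall y : R, is_derive y (1 : R) h (d y)) -> (forall y, 0 <= y -> 0 <= d y) ->
  0 <= z -> h 0 <= h z.
Proof.
move=> dh d_ge0 z_ge0.
apply: (@ger0_derive1_le_cc R h 0 z); last by [].
- by move=> y _; case: (dh y).
- move=> y; rewrite in_itv/= => /andP[/ltW y0 _].
  by rewrite derive1E; case: (dh y) => _ ->; exact: d_ge0.
- apply: continuous_subspaceT => y; apply: differentiable_continuous.
  by apply/derivable1_diffP; case: (dh y).
- by rewrite in_itv/= lexx.
- by rewrite in_itv/= lexx andbT.
Qed.

Lemma is_derive_expR_scale {R : realType} (a y : R) :
  is_derive y (1 : R) (fun y => expR (a * y)) (a * expR (a * y)).
Proof.
have -> : (fun y => expR (a * y)) = expR \o (a *: @id R) by [].
apply: is_derive_eq.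
by rewrite /GRing.scale/= mulr1 mulrC.
Qed.

(** The integral of [expR (r * u)] for [u] from [0] to [z]. *)
Definition growth {R : realType} (r z : R) : R :=
  if r == 0 then z else (expR (r * z) - 1) / r.

Lemma is_derive_growth {R : realType} (r y : R) :
  is_derive y (1 : R) (growth r) (expR (r * y)).
Proof.
rewrite /growth; case: eqP => [->|/eqP r0].
  by rewrite mul0r expR0; exact: is_derive_id.
have E := is_derive_expR_scale r y.
have -> : (fun z => (expR (r * z) - 1) / r) =
   r^-1 *: ((fun z => expR (r * z)) - cst 1).
  by apply/funext => z /=; rewrite /GRing.scale/= mulrC.
apply: is_derive_eq.
by rewrite subr0 /GRing.scale/= mulrA mulVf// mul1r.
Qed.

Lemma growthN {R : realType} (r z : R) : growth r (- z) = - growth (- r) z.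
Proof.
rewrite /growth oppr_eq0; case: eqP => // _.
by rewrite mulrN mulNr invrN mulrN opprK.
Qed.

(** The integrand [expR (r * u)] increases with [r], so for [-1 <= r] the
    integral is at least its value at [r = -1], which is [1 - expR (- z)].  For
    [r < -1] the integral is [(1 - expR (r * z)) / - r], whose numerator
    increases with [- r]. *)
Lemma growth_ge {R : realType} (r z : R) : 0 <= z ->
  (1 - expR (- z)) / (1 + `|r|) <= growth r z.
Proof.
move=> z0.
have expN1 : 0 <= 1 - expR (- z) by rewrite subr_ge0 expR_le1 oppr_le0.
have den_gt0 : 0 < 1 + `|r| by rewrite ltr_pwDl.
have [r_ge|r_lt] := leP (-1) r.
  apply: (@le_trans _ _ (1 - expR (- z))).
    by rewrite ler_pdivrMr// ler_peMr// lerDl.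
  have D y : is_derive y (1 : R) (growth r - growth (-1))
      (expR (r * y) - expR (-1 * y)).
    have E1 := is_derive_growth r y; have E2 := is_derive_growth (-1) y.
    exact: is_derive_eq.
  have := nonneg_derivative_le _ _ z D.
  rewrite /= !fctE /growth !mulr0 expR0 subrr !mul0r.
  rewrite (_ : (-1 == 0 :> R) = false); last first.
    by apply/negbTE; rewrite oppr_eq0 oner_eq0.
  rewrite invrN1 mulrN1 opprB mulN1r if_same subrr subr_ge0; apply => //.
  by move=> y y0; rewrite subr_ge0 ler_expR ler_wpM2r.
have r0 : r < 0 by lra.
rewrite /growth lt_eqF// (_ : (_ - 1) / r = (1 - expR (r * z)) / - r); last first.
  by rewrite invrN mulrN -mulNr opprB.
have -> : `|r| = - r by rewrite ltr0_norm.
apply: ler_pM => //; first by rewrite invr_ge0; lra.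
  rewrite lerD2l lerN2 ler_expR -subr_ge0.
  by rewrite -mulN1r -mulrBl mulr_ge0//; lra.
by rewrite lef_pV2 ?posrE; lra.
Qed.

(** [phi s] in the variable [y = ln x].  Powers and logarithms become
    exponentials, and the derivative takes the same form for every [s], with
    no case distinction at [s = 0] and [s = 1]. *)
Definition phi_exp {R : realType} (s y : R) : R :=
  if s == 0 then expR y - y - 1
  else if s == 1 then expR y * (y - 1) + 1
  else (1 - s + s * expR y - expR (s * y)) / (s * (1 - s)).

Lemma phi_expR {R : realType} (s y : R) : phi s (expR y) = (phi_exp s y)%:E.
Proof.
rewrite /phi /phi_exp expR_eq0 expRK andbF -expRM [y * s]mulrC.
by case: ifP => // _; case: ifP.
Qed.

Lemma phi_exp0 {R : realType} (s : R) : phi_exp s 0 = 0.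
Proof.
rewrite /phi_exp mulr0 expR0.
by do 2?[case: eqP => _]; ring.
Qed.

Lemma is_derive_phi_exp {R : realType} (s y : R) :
  is_derive y (1 : R) (phi_exp s) (expR y * growth (s - 1) y).
Proof.
rewrite /phi_exp; case: eqP => [->|/eqP s0].
  rewrite /growth sub0r oppr_eq0 oner_eq0 invrN1 mulrN1 mulN1r.
  have -> : (fun y : R => expR y - y - 1) = expR - id - cst 1 by [].
  apply: is_derive_eq.
  by rewrite subr0 opprB mulrBr mulr1 -expRD subrr expR0.
case: eqP => [->|/eqP s1].
  rewrite subrr /growth eqxx.
  have -> : (fun y : R => expR y * (y - 1) + 1) = expR * (id - cst 1) + cst 1.
    by [].
  apply: is_derive_eq; rewrite !fctE /GRing.scale/=.
  by ring.
have E := is_derive_expR_scale s y.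
have s1' : s - 1 != 0 by rewrite subr_eq0.
have -> : (fun y => (1 - s + s * expR y - expR (s * y)) / (s * (1 - s))) =
   (s * (1 - s))^-1 *: (cst (1 - s) + s *: expR - (fun z => expR (s * z))).
  by apply/funext => z /=; rewrite /GRing.scale/= mulrC.
apply: is_derive_eq.
rewrite /growth (negbTE s1') /GRing.scale/=.
have -> : expR (s * y) = expR ((s - 1) * y) * expR y.
  by rewrite -expRD mulrBl mul1r subrK.
have s1'' : 1 - s != 0 by rewrite -opprB oppr_eq0.
by field; rewrite s0 s1' s1''.
Qed.

(** Both sides vanish at [0] and the left derivative is the smaller one, by
    [growth_ge].  The left side is a multiple of [phi (-1)], that is of
    [(x - 1) ^+ 2 / x] for [x = expR y]: quadratic near [1] and linear at
    infinity. *)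
Lemma phi_exp_ge_pos {R : realType} (s y : R) : 0 <= y ->
  (expR y + expR (- y) - 2) / (2 * (1 + `|s - 1|)) <= phi_exp s y.
Proof.
move=> y0; have den_gt0 : 0 < 1 + `|s - 1| by rewrite ltr_pwDl.
pose c := (2 * (1 + `|s - 1|))^-1.
have D z : is_derive z (1 : R)
    (phi_exp s - c *: (expR + (fun y => expR (-1 * y)) - cst 2))
    (expR z * growth (s - 1) z - c * (expR z - expR (- z))).
  have E1 := is_derive_phi_exp s z; have E2 := is_derive_expR_scale (-1) z.
  by apply: is_derive_eq; rewrite subr0 /GRing.scale/= !mulN1r.
have := nonneg_derivative_le _ _ y D.
rewrite /= !fctE /GRing.scale/= phi_exp0 mulr0 expR0 sub0r.
rewrite (_ : 1 + 1 - 2 = 0 :> R) ?mulr0 ?oppr0 ?subr_ge0; last by ring.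
rewrite mulN1r mulrC; apply => //.
move=> z z0; rewrite subr_ge0.
apply: (@le_trans _ _ (expR z * ((1 - expR (- z)) / (1 + `|s - 1|)))); last first.
  by rewrite ler_pM2l ?expR_gt0// growth_ge.
(* (exp z - 1) (1 - exp (-z)) >= 0 is what 1 - exp (-2z) <= 2 (1 - exp (-z))
   becomes after multiplication by exp z *)
have z1 : expR z * expR (- z) = 1 by rewrite -expRD subrr expR0.
have zle1 : expR (- z) <= 1 by rewrite expR_le1 oppr_le0.
have zge1 : 1 <= expR z by rewrite -expR0 ler_expR.
have : 0 <= (expR z - 1) * (1 - expR (- z)) by rewrite mulr_ge0 ?subr_ge0.
move=> le2; rewrite /c invfM -subr_ge0.
rewrite (_ : _ - _ = (1 + `|s - 1|)^-1 / 2 *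
    ((expR z - 1) * (1 - expR (- z)) + (1 - expR z * expR (- z)))); last first.
  by field; rewrite gt_eqF.
by rewrite z1 subrr addr0 mulr_ge0// divr_ge0// invr_ge0 ltW.
Qed.

(** Same comparison of derivatives on the other side of [x = 1], where the lower
    bound is a multiple of [phi 2], that is of [(x - 1) ^+ 2]. *)
Lemma phi_exp_ge_neg {R : realType} (s z : R) : 0 <= z ->
  (1 - expR (- z)) ^+ 2 / (2 * (1 + `|s - 1|)) <= phi_exp s (- z).
Proof.
move=> z0; have den_gt0 : 0 < 1 + `|s - 1| by rewrite ltr_pwDl.
pose c := (2 * (1 + `|s - 1|))^-1.
pose dh y := expR (- y) * growth (1 - s) y -
  c * (2 * (1 - expR (- y)) * expR (- y)).
have D y : is_derive y (1 : R)
    (phi_exp s \o -%R - c *: ((cst 1 - (fun y => expR (-1 * y))) ^+ 2)) (dh y).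
  have E1 := is_derive_phi_exp s (- y).
  have E2 := is_derive_expR_scale (-1) y.
  apply: is_derive_eq; rewrite growthN /dh /GRing.scale/= !mulN1r !fctE
    !mulN1r (opprB s 1).
  by ring.
have := nonneg_derivative_le _ _ z D.
rewrite /= !fctE /GRing.scale/= oppr0 phi_exp0 mulr0 expR0 subrr expr0n mulr0.
rewrite subrr subr_ge0 mulN1r mulrC; apply => //.
move=> y y0; rewrite /dh subr_ge0.
apply: (@le_trans _ _ (expR (- y) * ((1 - expR (- y)) / (1 + `|1 - s|)))); last first.
  by rewrite ler_pM2l ?expR_gt0// growth_ge.
rewrite distrC /c le_eqVlt; apply/orP; left; apply/eqP.
by field; rewrite gt_eqF.
Qed.

Lemma phi_ge {R : realType} (s x : R) : 0 < x ->
  (((x - 1) ^+ 2 / Num.max 1 x / (2 * (1 + `|s - 1|)))%:E <= phi s x)%E.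
Proof.
move=> x0; have [y xE] : exists y, x = expR y.
  by have [y] := expR_total x0; exists y.
rewrite xE phi_expR lee_fin.
have [y0|y0] := leP 0 y.
  (* (x - 1)^2 / x = x + 1/x - 2 *)
  rewrite max_r; last by rewrite -expR0 ler_expR.
  apply: le_trans (phi_exp_ge_pos s y y0).
  rewrite expRN le_eqVlt; apply/orP; left; apply/eqP; congr (_ * _).
  by field; rewrite expR_eq0.
rewrite max_l; last by rewrite expR_le1 ltW.
rewrite divr1 -(opprK y); apply: le_trans (phi_exp_ge_neg s (- y) _).
  by rewrite opprK -opprB sqrrN.
by rewrite oppr_ge0 ltW.
Qed.

(** One of the two nonnegative terms of the divergence already gives the bound,
    because [v * Num.max 1 (u / v)] is the maximum of [u] and [v], hence at most
    [v + `|u - v|].  The bound is quadratic in the deviation when it is smaller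
    than [v] and linear when it is larger. *)
Lemma phi_div_ge {R : realType} (s u v : R) : 0 < u < 1 -> 0 < v < 1 ->
  (((u - v) ^+ 2 / (v + `|u - v|) / (2 * (1 + `|s - 1|)))%:E
    <= phi_div s u v)%E.
Proof.
move=> /andP[u0 u1] /andP[v0 v1]; rewrite /phi_div.
have phi_ge0 x : 0 < x -> (0 <= phi s x)%E.
  move=> x0; apply: le_trans (phi_ge s x x0).
  rewrite lee_fin !divr_ge0 ?sqr_ge0 ?mulr_ge0 ?addr_ge0//.
  by rewrite le_max ler01.
rewrite -[leLHS]adde0; apply: leeD; last first.
  by rewrite mule_ge0 ?lee_fin ?phi_ge0 ?divr_gt0 ?subr_gt0// subr_ge0 ltW.
apply: le_trans (lee_wpmul2l _ (phi_ge s _ (divr_gt0 u0 v0))); last first.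
  by rewrite lee_fin ltW.
rewrite -EFinM lee_fin mulrA ler_wpM2r ?invr_ge0 ?mulr_ge0 ?addr_ge0//.
rewrite (_ : u / v - 1 = (u - v) / v); last by field; rewrite gt_eqF.
have max_gt0 : 0 < Num.max 1 (u / v) by rewrite lt_max ltr01.
rewrite (_ : v * _ = (u - v) ^+ 2 / (v * Num.max 1 (u / v))); last first.
  by field; rewrite !gt_eqF.
have max_le : v * Num.max 1 (u / v) <= v + `|u - v|.
  rewrite maxr_pMr ?(ltW v0)// mulr1 mulrCA divff ?gt_eqF// mulr1.
  have := ler_norm (u - v); have := normr_ge0 (u - v).
  by case: (lerP v u) => *; lra.
have den_gt0 : 0 < v * Num.max 1 (u / v) by rewrite mulr_gt0.
rewrite ler_wpM2l ?sqr_ge0// lef_pV2 ?posrE//.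
exact: lt_le_trans max_le.
Qed.

Lemma phi_div_sym {R : realType} (s u v : R) :
  phi_div s (1 - u) (1 - v) = phi_div s u v.
Proof. by rewrite /phi_div !subKr addeC. Qed.

(** * Product measures and the empirical distribution function *)

Lemma distfunE {R : realType} (P : probability (measurableTypeR R) R) t :
  P `]-oo, t]%classic = (distfun P t)%:E.
Proof.
by rewrite /distfun fineK// fin_num_measure//; exact: measurable_itv.
Qed.

Lemma distfun_ge0_le1 {R : realType} (P : probability (measurableTypeR R) R) t :
  0 <= distfun P t <= 1.
Proof.
apply/andP; split; rewrite -lee_fin -distfunE //.
by apply: probability_le1; exact: measurable_itv.
Qed.

Lemma distfun_mixture {R : realType} (e : {i01 R})
    (P Q : probability (measurableTypeR R) R) t :
  distfun (mixture e P Q) t = (1 - e%:num) * distfun P t + e%:num * distfun Q t.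
Proof.
have -> : distfun (mixture e P Q) t = fine (mixture e P Q `]-oo, t]%classic).
  by [].
by rewrite mixtureE !distfunE.
Qed.

(** The integral of a nonnegative function is by definition the supremum of the
    integrals of the simple functions below it, so it is monotone whether or
    not the functions are measurable. *)
Lemma ge0_integral_mono {d} {T : measurableType d} {R : realType}
    (mu : {measure set T -> \bar R}) (f g : T -> \bar R) :
  (forall x, (0 <= f x)%E) -> (forall x, (f x <= g x)%E) ->
  (\int[mu]_x f x <= \int[mu]_x g x)%E.
Proof.
move=> f0 fg; rewrite !ge0_integralTE//; last first.
  by move=> x; exact: le_trans (fg x).
apply: ereal_sup_le => _ [h hf <-].
by exists h => // x; exact: le_trans (fg x).
Qed.

(** Monotonicity on arbitrary sets makes it possible to compare events about a
    supremum over uncountably many points, of unclear measurability, with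
    events of the form [`|edf x t - q| < r] at a single point [t]. *)
Lemma prob_power_le {d} {T : measurableType d} {R : realType}
    (P : probability T R) n (A B : set (n.-tuple T)) :
  A `<=` B -> (prob_power P n A <= prob_power P n B)%E.
Proof.
elim: n A B => [|n IH] A B AB /=.
  rewrite !diracE lee_fin ler_nat.
  case: (boolP (_ \in A)) => //; rewrite inE => /AB BA.
  by rewrite mem_set.
apply: ge0_integral_mono => x //.
by apply: IH => y; rewrite /xsection/= !inE; exact: AB.
Qed.

Lemma prob_power_le1 {d} {T : measurableType d} {R : realType}
    (P : probability T R) n (A : set (n.-tuple T)) : (prob_power P n A <= 1)%E.
Proof.
by rewrite -(probability_setT (prob_power P n)); exact: prob_power_le.
Qed.

(** Indexing by the truth value of [x <= t] makes the event that a sample has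
    a given pattern of such values a product of half-lines. *)
Definition half_line {R : realType} (t : R) (b : bool) :
    set (measurableTypeR R) :=
  [set x | (x <= t :> R) = b].

Lemma half_lineT {R : realType} (t : R) : half_line t true = `]-oo, t]%classic.
Proof. by apply/seteqP; split => x; rewrite /half_line/= in_itv. Qed.

Lemma half_lineF {R : realType} (t : R) :
  half_line t false = ~` half_line t true.
Proof. by apply/seteqP; split => x; rewrite /half_line/=; case: (_ <= _). Qed.

Lemma measurable_half_line {R : realType} (t : R) b : measurable (half_line t b).
Proof.
have mT : measurable (half_line t true).
  by rewrite half_lineT; exact: measurable_itv.
by case: b => //; rewrite half_lineF; exact: measurableC.
Qed.

Lemma prob_half_line {R : realType} (P : probability (measurableTypeR R) R) t b :
  P (half_line t b) = (if b then distfun P t else 1 - distfun P t)%:E.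
Proof.
have fP : P (half_line t true) = (distfun P t)%:E.
  by rewrite half_lineT distfunE.
case: b => //; rewrite half_lineF probability_setC ?fP//.
exact: measurable_half_line.
Qed.

Lemma prob_power_pattern {R : realType} (P : probability (measurableTypeR R) R)
   n (t : R) (s : {ffun 'I_n -> bool}) :
  prob_power P n [set x | forall i, half_line t (s i) (tnth x i)] =
  (\prod_(i < n) (if s i then distfun P t else 1 - distfun P t))%:E.
Proof.
rewrite (@prob_powerE _ _ _ P n (fun i => half_line t (s i))); last first.
  by move=> i; exact: measurable_half_line.
by rewrite -prodEFin; apply: eq_bigr => i _; rewrite prob_half_line.
Qed.

(** The second moment of a sum of [n] independent centred indicators: in the
    expansion of the square the mixed terms vanish and each of the [n] diagonal
    terms is the variance [q * (1 - q)]. *)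
Lemma binary_second_moment {R : comRingType} (q : R) n :
  \sum_(s : {ffun 'I_n -> bool})
     (\prod_(i < n) (if s i then q else 1 - q)) *
     (\sum_(i < n) ((s i)%:R - q)) ^+ 2
  = n%:R * (q * (1 - q)).
Proof.
pose w (b : bool) := if b then q else 1 - q.
pose c (b : bool) := b%:R - q.
(* expanding the square, the (i, j) term of the sum over all patterns is the
   product over k of the sums of G i j k *)
pose G (i j k : 'I_n) b :=
  w b * ((if k == i then c b else 1) * (if k == j then c b else 1)).
transitivity (\sum_(i < n) \sum_(j < n) \prod_(k < n) \sum_b G i j k b).
  under [RHS]eq_bigr do under eq_bigr do rewrite bigA_distr_bigA/=.
  under [RHS]eq_bigr do rewrite exchange_big.
  rewrite [RHS]exchange_big/=; apply: eq_bigr => s _.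
  rewrite expr2 mulr_suml mulr_sumr; apply: eq_bigr => i _.
  rewrite mulr_sumr mulr_sumr; apply: eq_bigr => j _.
  rewrite !big_split/= -!big_mkcond/= !big_pred1_eq.
  by rewrite /w /c.
rewrite [RHS]mulr_natl -[n in RHS]card_ord -sumr_const; apply: eq_bigr => i _.
rewrite (bigD1 i)//= [X in _ + X]big1 ?addr0 => [|j ji].
  rewrite (bigD1 i)//= [X in _ * X]big1 ?mulr1 => [|k ki].
    by rewrite big_bool /G /w /c eqxx/=; ring.
  by rewrite big_bool /G /w /c (negbTE ki)/=; ring.
have G0 : \sum_b G i j i b = 0.
  by rewrite big_bool /G /w /c eqxx eq_sym (negbTE ji)/=; ring.
by rewrite (bigD1 i)//= G0 mul0r.
Qed.

Lemma measure_bigsetU_le {d} {T : ringOfSetsType d} {R : realFieldType}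
    (mu : {content set T -> \bar R}) (I : Type) (r : seq I) (P : pred I)
    (F : I -> set T) : (forall i, measurable (F i)) ->
  (mu (\big[setU/set0]_(i <- r | P i) F i) <= \sum_(i <- r | P i) mu (F i))%E.
Proof.
move=> mF; apply: (@proj2 (measurable (\big[setU/set0]_(i <- r | P i) F i))).
apply: (big_rec2 (fun A x => measurable A /\ (mu A <= x)%E)) => [|i A x _ [mA le]].
  by rewrite measure0; split.
split; first exact: measurableU.
by apply: (le_trans (measureU2 _ (mF i) mA)); exact: leeD.
Qed.

Lemma measurable_pattern {R : realType} n (t : R) (s : {ffun 'I_n -> bool}) :
  measurable [set x : n.-tuple (measurableTypeR R) |
    forall i, half_line t (s i) (tnth x i)].
Proof.
rewrite [X in measurable X](_ : _ = \bigcap_(i in [set: 'I_n])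
    ((fun x : n.-tuple (measurableTypeR R) => tnth x i) @^-1`
      half_line t (s i))); last first.
  by apply/seteqP; split => x /= xs i; [move=> _|]; exact: xs.
apply: fin_bigcap_measurable; first exact: finite_finset.
move=> i _; rewrite -[X in measurable X]setTI.
by apply: measurable_tnth => //; exact: measurable_half_line.
Qed.

(** Chebyshev's inequality for the binomial count, carried out on the finitely
    many patterns [i |-> (tnth x i <= t)], whose probabilities are products. *)
Lemma edf_concentration {R : realType} (P : probability (measurableTypeR R) R)
    n (t r : R) (q := distfun P t) : (0 < n)%N -> 0 < r ->
  ((1 - q * (1 - q) / (n%:R * r ^+ 2))%:E <=
   prob_power P n [set x | (`|edf x t - q| < r)%R])%E.
Proof.
move=> n0 r0.
have nR0 : 0 < n%:R :> R by rewrite ltr0n.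
pose dev (s : {ffun 'I_n -> bool}) := \sum_(i < n) ((s i)%:R - q).
pose far s := n%:R * r <= `|dev s|.
pose pat s := [set x : n.-tuple (measurableTypeR R) |
    forall i, half_line t (s i) (tnth x i)].
pose B := \big[setU/set0]_(s | far s) pat s.
have mB : measurable B.
  by apply: bigsetU_measurable => s _; exact: measurable_pattern.
have PB : (prob_power P n B <= (q * (1 - q) / (n%:R * r ^+ 2))%:E)%E.
  apply: le_trans (measure_bigsetU_le _ _ _ _ _ _) _.
    by move=> s; exact: measurable_pattern.
  rewrite (eq_bigr (fun s : {ffun 'I_n -> bool} =>
    (\prod_(i < n) (if s i then q else 1 - q))%:E)); last first.
    by move=> s _; exact: prob_power_pattern.
  rewrite sumEFin lee_fin.
  have q01 : 0 <= q <= 1 by exact: distfun_ge0_le1.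
  have w_ge0 (s : {ffun 'I_n -> bool}) :
      0 <= \prod_(i < n) (if s i then q else 1 - q).
    by apply: prodr_ge0 => i _; case: ifP => _; lra.
  rewrite [leRHS](_ : _ = (n%:R * (q * (1 - q))) / (n%:R * r) ^+ 2); last first.
    by field; rewrite !gt_eqF.
  rewrite -binary_second_moment mulr_suml [leRHS](bigID far)/=.
  rewrite -[leLHS]addr0; apply: lerD; last first.
    apply: sumr_ge0 => s _.
    exact: divr_ge0 (mulr_ge0 (w_ge0 s) (sqr_ge0 _)) (sqr_ge0 _).
  (* on a far pattern, dev s ^+ 2 / (n r)^2 >= 1 *)
  apply: ler_sum => s fs; rewrite -mulrA ler_peMr//.
  rewrite ler_pdivlMr ?mul1r ?exprn_gt0 ?mulr_gt0//.
  by rewrite -[leRHS]real_normK ?num_real// lerXn2r ?nnegrE ?mulr_ge0// ltW.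
apply: (@le_trans _ _ (prob_power P n (~` B))).
  rewrite probability_setC// EFinB; apply: leeB => //.
apply: prob_power_le => x /= nBx.
rewrite ltNge; apply/negP => far_x; apply: nBx.
pose s := [ffun i => tnth x i <= t].
have devE : edf x t - q = n%:R^-1 * dev s.
  rewrite /dev sumrB sumr_const card_ord -[q *+ n]mulr_natl mulrBr.
  rewrite mulrA mulVf ?gt_eqF// mul1r /edf; congr (_ * _ - _).
  by apply: eq_bigr => i _; rewrite ffunE.
have far_s : far s.
  rewrite /far mulrC -ler_pdivlMr//; apply: le_trans far_x _.
  by rewrite devE normrM ger0_norm ?invr_ge0 ?ler0n// mulrC.
rewrite /B (bigD1 s)//=; by left => i; rewrite /half_line/= ffunE.
Qed.

(** * The statistic at one point *)

Lemma order_stat1_le {R : realType} n (x : n.-tuple R) (i : 'I_n) :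
  order_stat x 1 <= tnth x i.
Proof.
have xi : tnth x i \in sort <=%R x by rewrite mem_sort mem_tnth.
rewrite -(nth_index 0 xi) /order_stat.
apply: (sorted_leq_nth le_trans le_refl) => //; rewrite ?inE ?index_mem//.
  exact: sort_le_sorted.
by apply: leq_ltn_trans (_ : index (tnth x i) (sort <=%R x) < _)%N;
  rewrite ?index_mem.
Qed.

Lemma le_order_stat_max {R : realType} n (x : n.-tuple R) (i : 'I_n) :
  tnth x i <= order_stat x n.
Proof.
have xi : tnth x i \in sort <=%R x by rewrite mem_sort mem_tnth.
have n0 : (0 < n)%N by case: n i {x xi} => [[]|].
rewrite -(nth_index 0 xi) /order_stat.
have ltn : (index (tnth x i) (sort <=%R x) < n)%N.
  by rewrite -[ltnRHS](size_tuple x) -(size_sort <=%R) index_mem.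
apply: (sorted_leq_nth le_trans le_refl) => //;
  rewrite ?inE ?size_sort ?size_tuple//.
- exact: sort_le_sorted.
- by rewrite prednK.
- by rewrite -ltnS prednK.
Qed.

Lemma order_stat_edf {R : realType} n (x : n.-tuple R) (t : R) :
  0 < edf x t < 1 -> order_stat x 1 <= t < order_stat x n.
Proof.
move=> /andP[f0 f1].
have n0 : (0 < n)%N.
  by case: n x f0 {f1} => // x; rewrite /edf big_ord0 mulr0 ltxx.
have nR0 : 0 < n%:R :> R by rewrite ltr0n.
apply/andP; split.
  have [i xi] : exists i, tnth x i <= t.
    apply: contrapT => /forallNP nle; move: f0; rewrite /edf big1 ?mulr0 ?ltxx//.
    by move=> i _; case: (boolP (_ <= _)) => // /nle.
  exact: le_trans (order_stat1_le n x i) xi.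
have [i xi] : exists i, t < tnth x i.
  apply: contrapT => /forallNP nlt; move: f1; rewrite /edf.
  rewrite (eq_bigr (fun=> 1)) => [|i _]; last first.
    by rewrite leNgt (introF idP (nlt i)).
  by rewrite sumr_const card_ord mulVf ?ltxx// gt_eqF.
exact: lt_le_trans xi (le_order_stat_max _ _ _).
Qed.

(** An empirical value strictly between [0] and [1] at [t] means that [t] lies
    between the extreme order statistics. *)
Lemma phi_stat_ge {R : realType} (F0 : R -> R) s n (x : n.-tuple R) t :
  0 < edf x t < 1 -> 0 < F0 t < 1 ->
  (phi_div s (edf x t) (F0 t) <= phi_stat F0 s x)%E.
Proof.
move=> f01 F01; apply: ereal_sup_ubound; exists t => //; split => //.
exact: order_stat_edf.
Qed.

Definition tail_min {R : realType} (w : R) : R := Num.min w (1 - w).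

(** The lower bound of [phi_div_ge_tail], up to its constant factor, when the
    noise has mass [w] and the signal mass [m] to the left of a point: the mean
    of the empirical distribution function there is [w + e * (m - w)]. *)
Definition gain {R : realType} (e w m : R) : R :=
  (e * (m - w)) ^+ 2 / (tail_min w + `|e * (m - w)|).

(** The divergence is invariant under [u |-> 1 - u] and [v |-> 1 - v], so that
    [v] in [phi_div_ge] may be replaced by the smaller of the two tails. *)
Lemma phi_div_ge_tail {R : realType} (s u v : R) : 0 < u < 1 -> 0 < v < 1 ->
  (((u - v) ^+ 2 / (tail_min v + `|u - v|) / (2 * (1 + `|s - 1|)))%:E
    <= phi_div s u v)%E.
Proof.
move=> u01 v01; rewrite /tail_min; case: (leP v (1 - v)) => _.
  exact: phi_div_ge.
have := phi_div_ge s (1 - u) (1 - v).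
rewrite phi_div_sym (_ : 1 - u - (1 - v) = - (u - v)); last by ring.
rewrite sqrrN normrN.
by apply; lra.
Qed.

(** The empirical distribution function at [t] has mean [q] with
    [`|q - w| = d] and variance at most [(tail_min w + d) / n].  Hence it lies
    within [d / 2] of [q], at distance at least [d / 2] from [w], with
    probability at least [1 - 4 / (n * B)], and there the divergence is at
    least of order [B].  Noncentrality and variance thus enter through the same
    quantity [n * B]. *)
Lemma phi_stat_gain {R : realType} (P0 mu : probability (measurableTypeR R) R)
    (e : {i01 R}) (s t : R) n
    (w := distfun P0 t) (B := gain e%:num w (distfun mu t)) :
  (0 < n)%N -> e%:num <= 2^-1 -> 0 < w < 1 -> 0 < B ->
  ((1 - 4 / (n%:R * B))%:E <= prob_power (mixture e P0 mu) n
    [set x | ((B / (8 * (1 + `|s - 1|)))%:E <= phi_stat (distfun P0) s x)%E])%E.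
Proof.
move=> n0; rewrite {}/B /gain; set m := distfun mu t.
have /andP[] := distfun_ge0_le1 mu t; rewrite -/m => m0 m1.
have e0 : 0 <= e%:num by [].
have := distfun_mixture e P0 mu t; rewrite -/w -/m.
set Q := mixture e P0 mu; set q := distfun Q t; move: e0; set ee := e%:num.
move=> e0 qE e_le w01 B_gt0.
have qwE : q - w = ee * (m - w) by rewrite qE; ring.
move: B_gt0; rewrite -qwE.
set M := tail_min w; set d := `|q - w| => B_gt0.
have d_sq : (q - w) ^+ 2 = d ^+ 2 by rewrite real_normK ?num_real.
have d_gt0 : 0 < d.
  rewrite normr_gt0; apply/eqP => qw0; move: B_gt0.
  by rewrite /d qw0 expr0n mul0r ltxx.
have M_gt0 : 0 < M by rewrite /M /tail_min lt_min subr_gt0.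
have nR0 : 0 < n%:R :> R by rewrite ltr0n.
have q01 : 0 <= q <= 1 by exact: distfun_ge0_le1.
have qq_le : q * (1 - q) <= M + d.
  have qq1 : q * (1 - q) <= q by nra.
  have qq2 : q * (1 - q) <= 1 - q by nra.
  have := ler_norm (q - w); have := ler_norm (w - q); rewrite distrC -/d.
  by rewrite /M /tail_min; case: (leP w (1 - w)) => *; lra.
apply: le_trans (le_trans (edf_concentration Q n t (d / 2) n0 _) _).
- rewrite lee_fin lerD2l lerN2 -/q.
  rewrite [leRHS](_ : _ = 4 / (n%:R * d ^+ 2) * (M + d)); last first.
    by rewrite d_sq; field; rewrite !gt_eqF// addr_gt0.
  rewrite [leLHS](_ : _ = 4 / (n%:R * d ^+ 2) * (q * (1 - q))); last first.
    by field; rewrite !gt_eqF.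
  by rewrite ler_wpM2l// divr_ge0// mulr_ge0 ?sqr_ge0// ltW.
- by rewrite divr_gt0.
apply: prob_power_le => x /=; set f := edf x t => fq.
have /andP[w_gt0 w_lt1] := w01.
have up : ee * (m - w) <= 2^-1 * (1 - w).
  apply: (@le_trans _ _ (ee * (1 - w))); first by rewrite ler_wpM2l// lerD2r.
  by rewrite ler_wpM2r// subr_ge0 ltW.
have lo : ee * (w - m) <= 2^-1 * w.
  apply: (@le_trans _ _ (ee * w)); first by rewrite ler_wpM2l// gerBl.
  by rewrite ler_wpM2r// ltW.
(* up and lo say that q moves at most half of the way from w to 1 or to 0, so
   that edf x t, which is within d / 2 of q, stays inside the unit interval *)
rewrite -qwE in up; rewrite -opprB mulrN -qwE opprB in lo.
have [f01 fw] : 0 < f < 1 /\ d / 2 <= `|f - w|.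
  move: fq; rewrite -/q ltr_norml => fq.
  have [qw|qw] := leP w q.
    have dE : d = q - w by rewrite /d ger0_norm ?subr_ge0.
    split; first by rewrite dE in fq; lra.
    by rewrite (le_trans _ (ler_norm _))//; lra.
  have dE : d = w - q by rewrite /d ltr0_norm ?opprB ?subr_lt0.
  split; first by rewrite dE in fq; lra.
  by rewrite distrC (le_trans _ (ler_norm _))//; lra.
apply: le_trans (phi_stat_ge (distfun P0) s n x t f01 w01).
apply: le_trans (phi_div_ge_tail s _ _ f01 w01).
have D_gt0 : 0 < 1 + `|s - 1| by rewrite ltr_pwDl.
rewrite lee_fin -/f -/w -/M d_sq -[(f - w) ^+ 2]real_normK ?num_real//.
move: fw; set a := `|f - w| => fw; have a_gt0 : 0 < a by lra.
rewrite [leLHS](_ : _ = (d ^+ 2 / 4) / (M + d) / (2 * (1 + `|s - 1|))); last first.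
  by field; rewrite !gt_eqF// addr_gt0.
rewrite ler_wpM2r//.
rewrite ler_pdivrMr ?addr_gt0// [leRHS]mulrAC ler_pdivlMr ?addr_gt0//.
have h1 : d ^+ 2 / 4 <= a ^+ 2.
  have -> : d ^+ 2 / 4 = (d / 2) ^+ 2 by field.
  by rewrite lerXn2r// nnegrE ltW// divr_gt0.
have h2 : d ^+ 2 / 4 * a <= a ^+ 2 * d.
  rewrite (_ : _ * a = a * d * (d / 4)); last by ring.
  rewrite (_ : a ^+ 2 * d = a * d * a); last by ring.
  by rewrite ler_wpM2l ?mulr_ge0 ?(ltW a_gt0) ?(ltW d_gt0)//; lra.
by rewrite !mulrDr lerD// ler_wpM2r// ltW.
Qed.

(** * Levels of a continuous distribution function *)

Lemma distfun_le {R : realType} (P : probability (measurableTypeR R) R) (x y : R) :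
  x <= y -> distfun P x <= distfun P y.
Proof.
move=> xy; rewrite -lee_fin -!distfunE; apply: le_measure;
  rewrite ?inE; [exact: measurable_itv|exact: measurable_itv|].
by move=> z /=; rewrite !in_itv/= => /le_trans; exact.
Qed.

Section distfun_limits.
Context {R : realType} (P : probability (measurableTypeR R) R).

Let idTR : measurableTypeR R -> R := idfun.

#[local] HB.instance Definition _ :=
  @isMeasurableFun.Build _ _ _ _ idTR (@measurable_id _ _ setT).

Lemma distfun_cvg1 : distfun P x @[x --> +oo] --> (1 : R).
Proof. by have /fine_cvg := cvg_cdfy1 (idTR : {RV P >-> R}). Qed.

Lemma distfun_cvg0 : distfun P x @[x --> -oo] --> (0 : R).
Proof. by have /fine_cvg := cvg_cdfNy0 (idTR : {RV P >-> R}). Qed.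

End distfun_limits.

(** The point is the largest one of its level, so that the sublevel set is a
    closed half-line even if [distfun P] is constant near [t]. *)
Lemma distfun_level {R : realType} (P : probability (measurableTypeR R) R)
    (w : R) : continuous (distfun P) -> 0 < w < 1 ->
  exists2 t, distfun P t = w & forall x, (distfun P x <= w) = (x <= t).
Proof.
move=> Fc /andP[w0 w1].
have [x0 Fx0] : exists x, distfun P x < w.
  have : \forall x \near -oo, distfun P x < w.
    by apply: cvgr_lt (distfun_cvg0 P) _ w0.
  by move=> /filter_ex.
have [x1 Fx1] : exists x, w < distfun P x.
  have : \forall x \near +oo, w < distfun P x.
    by apply: cvgr_gt (distfun_cvg1 P) _ w1.
  by move=> /filter_ex.
pose A := [set x | distfun P x <= w].
have supA : has_sup A.
  split; first by exists x0; exact: ltW.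
  exists x1 => x /= Fx; rewrite leNgt; apply/negP => /ltW /(distfun_le P).
  by rewrite leNgt (le_lt_trans Fx).
have t_ub x : distfun P x <= w -> x <= sup A by exact: sup_upper_bound.
have Ft_le : distfun P (sup A) <= w.
  rewrite leNgt; apply/negP => Ft.
  have /nbhs_ballP[r /= r0 Fr] : \forall y \near sup A, w < distfun P y.
    exact: cvgr_gt (Fc _) _ Ft.
  have [a /= Aa ta] := sup_adherent r0 supA.
  suff : w < distfun P a by rewrite ltNge Aa.
  apply: Fr; rewrite /ball/= ger0_norm ?subr_ge0 ?t_ub//; lra.
exists (sup A).
  apply/eqP; rewrite eq_le Ft_le/= leNgt; apply/negP => Ft.
  have /nbhs_ballP[r /= r0 Fr] : \forall y \near sup A, distfun P y < w.
    exact: cvgr_lt (Fc _) _ Ft.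
  have /ltW/t_ub : distfun P (sup A + r / 2) < w.
    apply: Fr; rewrite /ball/= opprD addrA subrr sub0r normrN ger0_norm; lra.
  by lra.
move=> x; apply/idP/idP => [/t_ub//|/(distfun_le P)/le_trans]; exact.
Qed.

(** * A point where the signal shows *)

(** [gain] with one chosen tail, of noise mass [w] and signal mass [m], in
    place of the smaller one. *)
Definition tail_gain {R : realType} (e w m : R) : R :=
  (e * (m - w)) ^+ 2 / (w + `|e * (m - w)|).

(** Here [b] is the signal mass of the tail that the noise sees (levels
    between [0] and [v]) and [a] the signal mass beyond the support of the
    noise.  At the level [v] the signal mass is [a + b], and [a] may cancel the
    difference between [b] and [v].  If it cancels at least half of it, then
    [a] is at least half of this difference and shows at any level
    [u <= e * a / 2]: the signal mass [m] is still at least [a], so that the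
    deviation exceeds the noise mass [u].  The gain is then linear in [e * a],
    and [1 <= n * v] turns the linear bound into the required one. *)
Lemma tail_gain_selection {R : realType} (n e v a b h : R) :
  0 < v -> 1 <= n * v -> 0 <= e <= 1 -> 0 <= a -> 2 <= h ->
  h <= Num.sqrt n * e / Num.sqrt v * `|b - v| ->
  h / 8 <= n * tail_gain e v (a + b) \/
  (0 < e * a /\ forall m, a <= m ->
     h / 8 <= n * tail_gain e (Num.min v (e * a / 2)) m).
Proof.
move=> v0 nv1 /andP[e0 e1] a0 h2.
have n0 : 0 < n by rewrite -(pmulr_lgt0 _ v0); lra.
pose y := Num.sqrt n / Num.sqrt v.
have y0 : 0 < y by rewrite divr_gt0 ?sqrtr_gt0.
have y2v : n = y ^+ 2 * v.
  rewrite /y exprMn exprVn !sqr_sqrtr ?ltW// mulfVK ?gt_eqF//.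
(* n * v = (y * v) ^+ 2 *)
have yv : 1 <= y * v.
  have yv0 : 0 <= y * v by rewrite mulr_ge0 ?(ltW y0) ?(ltW v0).
  rewrite leNgt; apply/negP => yv_lt1; move: nv1; rewrite y2v leNgt.
  rewrite (_ : _ * v = (y * v) ^+ 2); last by ring.
  by rewrite exprn_ilt1.
rewrite (_ : _ * `|b - v| = y * (e * `|b - v|)); last by rewrite /y; ring.
set D := `|b - v| => hD; clearbody y.
have [le|lt] := leP (D / 2) `|a + b - v|.
  left; rewrite /tail_gain -[(e * _) ^+ 2]real_normK ?num_real//.
  rewrite normrM ger0_norm//; set d := e * _.
  have yd : h / 2 <= y * d.
    rewrite ler_pdivrMr//; apply: le_trans hD _.
    by rewrite -mulrA ler_pM2l// -mulrA ler_wpM2l//; lra.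
  have d0 : 0 < d by rewrite -(pmulr_rgt0 _ y0); lra.
  rewrite mulrA ler_pdivlMr ?addr_gt0// y2v.
  (* quadratic regime for d <= v, linear regime for v < d *)
  have [dv|vd] := leP d v.
    have h1 : h / 4 <= (y * d) ^+ 2 by nra.
    apply: (@le_trans _ _ (h / 4 * v)); first by nra.
    rewrite (_ : _ * d ^+ 2 = (y * d) ^+ 2 * v); last by ring.
    by rewrite ler_wpM2r// ltW.
  have h1 : h / 2 <= (y * v) * (y * d).
    by apply: le_trans yd _; rewrite ler_peMl// mulr_ge0// ltW.
  apply: (@le_trans _ _ (h / 2 * d)); first by nra.
  rewrite (_ : _ * d ^+ 2 = (y * v) * (y * d) * d); last by ring.
  by rewrite ler_wpM2r// ltW.
right.
have aD : D / 2 <= a.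
  have : D <= `|a + b - v| + `|a|.
    by rewrite /D (_ : b - v = (a + b - v) - a) ?ler_normB//; ring.
  by rewrite [`|a|]ger0_norm//; lra.
have yea : h / 2 <= y * (e * a).
  rewrite ler_pdivrMr//; apply: le_trans hD _.
  by rewrite -mulrA ler_pM2l// -mulrA ler_wpM2l//; lra.
have ea0 : 0 < e * a by rewrite -(pmulr_rgt0 _ y0); lra.
split=> // m am; set u := Num.min _ _.
have u_le : u <= e * a / 2 by rewrite /u ge_min lexx orbT.
have u0 : 0 < u by rewrite /u lt_min v0 divr_gt0.
have eu : e * u <= e * a / 2.
  by apply: le_trans u_le; rewrite ler_piMl// ltW.
have em : e * a <= e * m by rewrite ler_wpM2l.
have d_ge : e * a / 2 <= e * (m - u) by rewrite mulrBr; lra.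
rewrite /tail_gain ger0_norm; last by apply: le_trans d_ge; lra.
move: d_ge; set d := e * (m - u) => d_ge; have d0 : 0 < d by lra.
rewrite mulrA ler_pdivlMr ?addr_gt0// y2v.
have h1 : h / 4 <= (y * v) * (y * d).
  apply: (@le_trans _ _ (y * d)); last by rewrite ler_peMl// mulr_ge0// ltW.
  have : y * (e * a / 2) <= y * d by rewrite ler_pM2l.
  by lra.
apply: (@le_trans _ _ (h / 4 * d)); first by nra.
rewrite (_ : _ * d ^+ 2 = (y * v) * (y * d) * d); last by ring.
by rewrite ler_wpM2r// ltW.
Qed.

Lemma tail_gain_le {R : realType} (e w m : R) : 0 <= w <= 1 ->
  tail_gain e w m <= gain e w m.
Proof.
move=> /andP[w0 w1]; rewrite /tail_gain /gain.
have Mw : tail_min w <= w by rewrite /tail_min ge_min lexx.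
have M0 : 0 <= tail_min w by rewrite /tail_min le_min w0 subr_ge0.
have [->|d0] := eqVneq (e * (m - w)) 0; first by rewrite expr0n !mul0r.
have d_gt0 : 0 < `|e * (m - w)| by rewrite normr_gt0.
rewrite ler_wpM2l ?sqr_ge0// lef_pV2 ?posrE ?ltr_wpDl//.
by rewrite lerD2r.
Qed.

Lemma gain_compl {R : realType} (e w m : R) :
  gain e (1 - w) (1 - m) = gain e w m.
Proof.
rewrite /gain (_ : 1 - m - (1 - w) = - (m - w)); last by ring.
by rewrite mulrN sqrrN normrN /tail_min subKr minC.
Qed.

Lemma measurable_preimage_distfun {R : realType}
    (P : probability (measurableTypeR R) R) (A : set R) :
  continuous (distfun P) -> measurable A -> measurable (distfun P @^-1` A).
Proof.
move=> Fc mA; rewrite -[X in measurable X]setTI.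
by apply: (measurable_realfun.continuous_measurable_fun Fc) => //; exact: measurableT.
Qed.

Lemma fine_measure_le {R : realType} (mu : probability (measurableTypeR R) R)
    (A B : set (measurableTypeR R)) : measurable A -> measurable B ->
  A `<=` B -> fine (mu A) <= fine (mu B).
Proof.
move=> mA mB AB; rewrite fine_le ?fin_num_measure//.
by apply: le_measure; rewrite ?inE.
Qed.

Lemma fine_measureU {R : realType} (mu : probability (measurableTypeR R) R)
    (A B : set (measurableTypeR R)) : measurable A -> measurable B ->
  A `&` B = set0 -> fine (mu (A `|` B)) = fine (mu A) + fine (mu B).
Proof.
by move=> mA mB AB; rewrite measureU// fineD ?fin_num_measure.
Qed.

Definition level_mass {R : realType} (F0 : R -> R)
    (mu : probability (measurableTypeR R) R) (A : set R) : R :=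
  fine (mu (F0 @^-1` A)).

Section level_mass_gain.
Context {R : realType} (P0 mu : probability (measurableTypeR R) R)
  (F0_continuous : continuous (distfun P0)).
Local Notation F0 := (distfun P0).
Local Notation mass := (level_mass F0 mu).

Let mpre (A : set R) : measurable A -> measurable (F0 @^-1` A).
Proof. exact: measurable_preimage_distfun. Qed.

Lemma level_massU (A B : set R) : measurable A -> measurable B ->
  A `&` B = set0 -> mass (A `|` B) = mass A + mass B.
Proof.
move=> mA mB AB; rewrite /level_mass preimage_setU fine_measureU//.
- exact: mpre.
- exact: mpre.
- by rewrite -preimage_setI AB preimage_set0.
Qed.

Lemma distfun_at_level (w : R) : 0 < w < 1 -> exists t, F0 t = w /\
  distfun mu t = mass `]-oo, w].
Proof.
move=> w01; have [t Ft Ht] := distfun_level P0 w F0_continuous w01.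
exists t; split => //; rewrite /level_mass /distfun; congr (fine (mu _)).
by apply/seteqP; split => x /=; rewrite !in_itv/= Ht.
Qed.

(** Here the signal mass that the noise does not see is the one where [F0]
    vanishes. *)
Lemma left_gain (n e v h : R) : 0 < v < 1 -> 1 <= n * v -> 0 <= e <= 1 ->
  2 <= h ->
  h <= Num.sqrt n * e / Num.sqrt v * `|mass `]0, v] - v| ->
  exists2 t, 0 < F0 t < 1 & h / 8 <= n * gain e (F0 t) (distfun mu t).
Proof.
move=> /andP[v0 v1] nv e01 h2 hH.
have n0 : 0 < n by rewrite -(pmulr_lgt0 _ v0); lra.
set a := mass `]-oo, 0].
have a0 : 0 <= a by exact: fine_ge0.
have [|[ea0 sel]] := tail_gain_selection n e v a _ h v0 nv e01 a0 h2 hH.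
  rewrite /a -level_massU//; last first.
    apply/seteqP; split => x //=; rewrite !in_itv/=; lra.
  rewrite (_ : _ `|` _ = `]-oo, v]%classic); last first.
    apply/seteqP; split => x /=; rewrite !in_itv/=.
      by case; lra.
    by move=> xv; case: (leP x 0) => x0; [left|right].
  have [|t [Ft mt]] := distfun_at_level v; first by rewrite v0.
  move=> le; exists t; rewrite Ft ?v0// mt; apply: le_trans le _.
  by rewrite ler_pM2l// tail_gain_le// !ltW.
set u := Num.min v (e * a / 2) in sel.
have u0 : 0 < u by rewrite /u lt_min v0 divr_gt0.
have u1 : u < 1 by rewrite /u gt_min v1.
have [|t [Ft mt]] := distfun_at_level u; first by rewrite u0.
exists t; rewrite Ft ?u0//; apply: le_trans (sel (distfun mu t) _) _.
  rewrite mt /a; apply: fine_measure_le; [exact: mpre|exact: mpre|].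
  by move=> x /=; rewrite !in_itv/=; lra.
by rewrite ler_pM2l// tail_gain_le// !ltW.
Qed.

(** The mirror image of [left_gain] under [x |-> 1 - x]: the tail masses at the
    level [1 - w] are [w] for the noise and [1 - distfun mu t] for the
    signal. *)
Lemma right_gain (n e v h : R) : 0 < v < 1 -> 1 <= n * v -> 0 <= e <= 1 ->
  2 <= h ->
  h <= Num.sqrt n * e / Num.sqrt v * `|mass `](1 - v), 1[ - v| ->
  exists2 t, 0 < F0 t < 1 & h / 8 <= n * gain e (F0 t) (distfun mu t).
Proof.
move=> /andP[v0 v1] nv e01 h2 hH.
have n0 : 0 < n by rewrite -(pmulr_lgt0 _ v0); lra.
set a := mass `[1, +oo[.
have a0 : 0 <= a by exact: fine_ge0.
have compl (w : R) : 1 - mass `]-oo, w] = mass `]w, +oo[.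
  have -> : 1 = mass setT.
    by rewrite /level_mass preimage_setT probability_setT.
  rewrite (_ : setT = `]-oo, w]%classic `|` `]w, +oo[%classic); last first.
    apply/esym/seteqP; split => x //= _; rewrite !in_itv/= andbT.
    by case: (leP x w) => xw; [left|right].
  rewrite level_massU//; first by rewrite addrAC subrr add0r.
  by apply/seteqP; split => x //=; rewrite !in_itv/=; lra.
have [|[ea0 sel]] := tail_gain_selection n e v a _ h v0 nv e01 a0 h2 hH.
  rewrite /a -level_massU//; last first.
    apply/seteqP; split => x //=; rewrite !in_itv/=; lra.
  rewrite (_ : _ `|` _ = `](1 - v), +oo[%classic); last first.
    apply/seteqP; split => x /=; rewrite !in_itv/=.
      by case; lra.
    by move=> xv; case: (leP 1 x) => x1; [left|right]; lra.
  have [|t [Ft mt]] := distfun_at_level (1 - v); first by lra.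
  move=> le; exists t; first by rewrite Ft; lra.
  rewrite -gain_compl Ft subKr mt compl; apply: le_trans le _.
  by rewrite ler_pM2l// tail_gain_le// !ltW.
set u := Num.min v (e * a / 2) in sel.
have u0 : 0 < u by rewrite /u lt_min v0 divr_gt0.
have u1 : u < 1 by rewrite /u gt_min v1.
have [|t [Ft mt]] := distfun_at_level (1 - u); first by lra.
exists t; first by rewrite Ft; lra.
rewrite -gain_compl Ft subKr; apply: le_trans (sel (1 - distfun mu t) _) _.
  rewrite mt compl /a; apply: fine_measure_le; [exact: mpre|exact: mpre|].
  by move=> x /=; rewrite !in_itv/=; lra.
by rewrite ler_pM2l// tail_gain_le// !ltW.
Qed.

(** One of the two summands of the signal strength is at least half of it. *)
Lemma signal_strength_gain (e v : R) n : 0 < v < 1 -> 1 <= n%:R * v ->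
  0 <= e <= 1 -> 4 <= signal_strength F0 mu e n v ->
  exists2 t, 0 < F0 t < 1 &
    signal_strength F0 mu e n v / 16 <= n%:R * gain e (F0 t) (distfun mu t).
Proof.
move=> v01 nv e01; set H := signal_strength _ _ _ _ _ => H4.
have HE : H = Num.sqrt n%:R * e / Num.sqrt v * `|mass `]0, v] - v| +
  Num.sqrt n%:R * e / Num.sqrt v * `|mass `](1 - v), 1[ - v|.
  by rewrite -mulrDr.
rewrite (_ : H / 16 = (H / 2) / 8); last by field.
have [le|le] := leP (H / 2)
   (Num.sqrt n%:R * e / Num.sqrt v * `|mass `]0, v] - v|).
  by apply: left_gain le => //; lra.
by apply: (right_gain n%:R e v) => //; lra.
Qed.

End level_mass_gain.

(** * Divergence of the statistic *)

Lemma near_lnln_ge {R : realType} (L : R) :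
  \forall n \near \oo, L <= ln (ln n%:R).
Proof.
near=> n.
have le : expR (expR L) <= n%:R by near: n; exact: nbhs_infty_ger.
have le1 : expR L <= ln n%:R.
  by rewrite -[leLHS]expRK ler_ln ?posrE ?expR_gt0//; apply: lt_le_trans le;
     exact: expR_gt0.
by rewrite -[leLHS]expRK ler_ln ?posrE ?expR_gt0//; apply: lt_le_trans le1;
  exact: expR_gt0.
Unshelve. all: by end_near. Qed.

Lemma centering_le {R : realType} n : 0 < ln (ln n%:R) :> R ->
  centering R n <= 2 * ln (ln n%:R).
Proof.
move=> L0; rewrite /centering; have := ln_sublinear L0.
have : 0 <= ln (4 * pi) :> R.
  by apply: ln_ge0; have := pi_ge2 R; lra.
by lra.
Qed.

(** The gain at the selected point is at least [H / 16], so [n] times the statistic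
    is at least [H / D] outside an event of probability at most [64 / H], while the
    centering together with [K] stays below [3 * L]. *)
Lemma phi_stat_exceeds {R : realType}
    (P0 mu : probability (measurableTypeR R) R) (e : {i01 R}) (v K s : R) n
    (H := signal_strength (distfun P0) mu e%:num n v) (L := ln (ln n%:R))
    (D := 128 * (1 + `|s - 1|)) :
  continuous (distfun P0) -> 0 < v < 2^-1 -> (0 < n)%N -> 1 <= n%:R * v ->
  e%:num <= 2^-1 -> 4 <= H -> 3 * D * L <= H -> K < L -> 0 < L ->
  ((1 - 64 / H)%:E <= prob_power (mixture e P0 mu) n
     [set x | (K%:E < n%:R%:E * phi_stat (distfun P0) s x
                        - (centering R n)%:E)%E])%E.
Proof.
move=> F0c v01 n0 nv e_le H4 HL KL L0.
have nR0 : 0 < n%:R :> R by rewrite ltr0n.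
have [||t F01 gain_ge] := signal_strength_gain P0 mu F0c e%:num v n _ nv _ H4.
- by lra.
- by rewrite ge0/= le1.
rewrite -/H in gain_ge; set B := gain _ _ _ in gain_ge.
have B0 : 0 < B by rewrite -(pmulr_rgt0 _ nR0); lra.
apply: le_trans (le_trans (phi_stat_gain P0 mu e s t n n0 e_le F01 B0) _).
  rewrite lee_fin lerD2l lerN2 -/B.
  rewrite ler_pdivrMr; last exact: mulr_gt0.
  by rewrite mulrAC ler_pdivlMr; lra.
apply: prob_power_le => x /=; rewrite -/B => B_le.
have D0 : 0 < 1 + `|s - 1| by rewrite ltr_pwDl.
apply: (@lt_le_trans _ _ ((n%:R * (B / (8 * (1 + `|s - 1|))) - centering R n)%:E)).
  rewrite lte_fin ltrBrDr.
  have := centering_le n L0; rewrite -/L => c_le.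
  apply: (@lt_le_trans _ _ (3 * L)); first by lra.
  rewrite mulrA ler_pdivlMr ?mulr_gt0//.
  by move: HL; rewrite /D; lra.
rewrite EFinD; apply: leeD2r; rewrite EFinM.
by apply: lee_wpmul2l => //; rewrite lee_fin ltW.
Qed.

Theorem theorem3p1 (R : realType)
    (P0 : probability (measurableTypeR R) R)
    (mu : nat -> probability (measurableTypeR R) R)
    (eps : nat -> {i01 R})
    (v : nat -> R)
    (P0_continuous : continuous (distfun P0))
    (eps_cvg0 : (eps n)%:num @[n --> \oo] --> (0 : R))
    (v_range : forall n, 0 < v n < 2^-1)
    (nv_cvgy : n%:R * v n @[n --> \oo] --> +oo)
    (H_cvgy : (ln (ln n%:R))^-1 *
        signal_strength (distfun P0) (mu n) (eps n)%:num n (v n)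
      @[n --> \oo] --> +oo)
    (s : R) :
  cvgy_in_probability
    (fun n => prob_power (mixture (eps n) P0 (mu n)) n)
    (fun n x => n%:R%:E * phi_stat (distfun P0) s x - (centering R n)%:E)%E.
Proof.
move=> K.
(* q is the ratio of the signal strength to ln (ln n) *)
set q := fun n : nat => _ * signal_strength _ _ _ _ _ in H_cvgy.
apply: (@squeeze_cvge _ _ _ _ (fun n => (1 - 64 / q n)%:E) _ (cst 1%E)).
- near=> n; rewrite prob_power_le1 andbT.
  have L_ge : `|K| + 1 <= ln (ln n%:R) by near: n; exact: near_lnln_ge.
  have q_ge : 4 + 3 * (128 * (1 + `|s - 1|)) <= q n.
    by near: n; exact: (cvgryPge _).1.
  have nv_ge : 1 <= n%:R * v n by near: n; exact: (cvgryPge _).1.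
  have e_le : (eps n)%:num <= 2^-1 :> R.
    by near: n; apply: (cvgr_le _ eps_cvg0); rewrite invr_gt0.
  have n_gt0 : (0 < n)%N by near: n; exact: nbhs_infty_gt.
  move: L_ge; set L := ln (ln n%:R) => L_ge.
  have [L1 KL] : 1 <= L /\ K < L.
    by have := ler_norm K; have := normr_ge0 K; lra.
  have L0 : 0 < L by lra.
  set H := signal_strength (distfun P0) (mu n) (eps n)%:num n (v n).
  have HE : H = q n * L by rewrite /q -/L -/H mulrAC mulVf ?mul1r// gt_eqF.
  have D0 : 0 < 1 + `|s - 1| by rewrite ltr_pwDl.
  have q_le : q n <= H by rewrite HE ler_peMr//; lra.
  apply: le_trans (phi_stat_exceeds P0 (mu n) (eps n) (v n) K s n _ _ _ _ _ _ _ _ _).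
  + rewrite lee_fin lerD2l lerN2 -/H ler_wpM2l// lef_pV2 ?posrE//; lra.
  + by [].
  + by [].
  + by [].
  + by [].
  + by [].
  + by rewrite -/H; lra.
  + by rewrite -/H -/L HE ler_wpM2r// ?(ltW L0)//; lra.
  + by [].
  + by [].
- apply/fine_cvgP; split; first exact: nearW.
  rewrite /comp/= -[X in _ --> X]subr0; apply: cvgB; first exact: cvg_cst.
  rewrite -(mulr0 64); apply: cvgM; first exact: cvg_cst.
  apply: (iffRL (gtr0_cvgV0 _)) => //.
  by near=> n; near: n; exact: (cvgryPgt _).1.
- exact: cvg_cst.
Unshelve. all: by end_near. Qed.
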